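(* Let $n\ge 2$, let $X_1,\ldots,X_n$ be independent identically distributed real random variables, and let $X_{(1)}\ge X_{(2)}\ge\ldots\ge X_{(n)}$ be their order statistics. Let $\tau(x)=e^x-x-1$ and $\psi(x)=e^x\tau(-x)=1+(x-1)e^x$ for $x\in\mathbb{R}$. (1) For every integer $k$ with $1\le k\le n/2$: if $X_{(k)}$ is square-integrable, then $$\operatorname{Var}[X_{(k)}]\le k\,\mathbb{E}\left[(X_{(k)}-X_{(k+1)})^2\right],$$ and for every $\lambda\in\mathbb{R}$ such that $\mathbb{E}[e^{\lambda X_{(k)}}]<\infty$ and $\mathbb{E}[|X_{(k)}|e^{\lambda X_{(k)}}]<\infty$, $$\operatorname{Ent}\left[e^{\lambda X_{(k)}}\right]\le k\,\mathbb{E}\left[e^{\lambda X_{(k+1)}}\,\psi\big(\lambda(X_{(k)}-X_{(k+1)})\big)\right].$$ (2) For every integer $k$ with $n/2<k\le n$: if $X_{(k)}$ is square-integrable, then $$\operatorname{Var}[X_{(k)}]\le (n-k+1)\,\mathbb{E}\left[(X_{(k-1)}-X_{(k)})^2\right],$$ and for every $\lambda\in\mathbb{R}$ such that $\mathbb{E}[e^{\lambda X_{(k)}}]<\infty$ and $\mathbb{E}[|X_{(k)}|e^{\lambda X_{(k)}}]<\infty$, $$\operatorname{Ent}\left[e^{\lambda X_{(k)}}\right]\le (n-k+1)\,\mathbb{E}\left[e^{\lambda X_{(k)}}\,\tau\big(\lambda(X_{(k-1)}-X_{(k)})\big)\right].$$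
   Context: The order statistics $X_{(1)}\ge\ldots\ge X_{(n)}$ are the non-increasing rearrangement of $X_1,\ldots,X_n$. The entropy of a non-negative random variable $X$ is $\operatorname{Ent}[X]=\mathbb{E}[X\log X]-\mathbb{E}X\,\log\mathbb{E}X$ (with $0\log 0=0$). The right-hand sides of the inequalities (expectations of non-negative random variables) are allowed to be $+\infty$. *)

(* Defs.v *)
From mathcomp Require Export all_boot all_order all_algebra.
From mathcomp Require Export all_classical all_reals all_analysis.

Set Implicit Arguments.
Unset Strict Implicit.
Unset Printing Implicit Defensive.

Import Order.TTheory GRing.Theory Num.Theory.
Import numFieldNormedType.Exports.

Local Open Scope classical_set_scope.
Local Open Scope ring_scope.
Local Open Scope ereal_scope.

Section RandomVariables.
Context (d : measure_display) (T : measurableType d) (R : realType)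
  (P : probability T R).

Definition mutually_independent (I : finType) (X : I -> {RV P >-> R}) : Prop :=
  forall (J : {set I}) (B : I -> set R),
    (forall i, measurable (B i)) ->
    P (\bigcap_(i in [set` J]) (X i @^-1` B i)) =
    \prod_(i in J) P (X i @^-1` B i).

Definition identically_distributed (I : finType) (X : I -> {RV P >-> R}) :
    Prop :=
  forall (i j : I) (B : set R), measurable B ->
    distribution P (X i) B = distribution P (X j) B.

(* The [k]-th largest of the values [X i w], with [k] counted from 1; only the
   ranks [1 <= k <= n] are meaningful. *)
Definition order_stat (n : nat) (X : 'I_n -> {RV P >-> R}) (k : nat) :
    T -> R :=
  fun w => nth 0%R (sort >=%R [seq X i w | i <- enum 'I_n]) k.-1.

Definition square_integrable (X : T -> R) : Prop := X \in Lfun P 2%:E.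

(* [0 * log 0 = 0] holds in both terms: [ln 0 = 0] in the first one, and
   [lne 0 = -oo] with [0 * -oo = 0] in the second. *)
Definition entropy (X : T -> R) : \bar R :=
  'E_P[fun w => (X w * ln (X w))%R] - 'E_P[X] * lne 'E_P[X].

End RandomVariables.

Definition tau (R : realType) (x : R) : R := (expR x - x - 1)%R.

Definition psi (R : realType) (x : R) : R := (expR x * tau (- x))%R.

Lemma psiE (R : realType) (x : R) : psi x = (1 + (x - 1) * expR x)%R.
Proof.
rewrite /psi /tau opprK !mulrDr mulrN1 expRxMexpNx_1 mulrBl mul1r.
by rewrite [(expR x * x)%R]mulrC addrA.
Qed.

(* Main.v *)
(** The left-hand sides are of the form E phi(Y) - phi(E Y), with phi(y) = y^2,
    Y = X_(k) and with phi(y) = y log y, Y = exp(l X_(k)).  For independent X_i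
    such a phi-entropy is at most the sum over i of E D(Y, Y_i), where D is the
    Bregman divergence of phi and Y_i is any function of the variables other
    than X_i.  To see this, integrate the coordinates out one at a time: for a
    single coordinate the expected divergence to a constant exceeds the
    phi-entropy by a divergence, which is nonnegative, and since D is jointly
    convex, averaging Y and Y_i over another coordinate can only decrease
    E D(Y, Y_i).

    Take Y_i to be an order statistic of the sample deprived of X_i.  Of rank k,
    it is X_(k+1) for k of the indices i and X_(k) for the others; of rank
    k - 1, it is X_(k-1) for n - k + 1 of the indices and X_(k) for the others.
    Ties only decrease the sum of the divergences.

    The inequality is applied to bounded Y, obtained by clamping X_(k) or
    l X_(k) to [-N, N]; clamping decreases the divergences, and N goes to
    infinity by dominated convergence on the left-hand side. *)

Require Import Defs.
From mathcomp Require Import zify ring lra measurable_realfun.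

Set Implicit Arguments.
Unset Strict Implicit.
Unset Printing Implicit Defensive.

Import Order.TTheory GRing.Theory Num.Theory.
Import numFieldNormedType.Exports.

Local Open Scope classical_set_scope.
Local Open Scope ring_scope.
Local Open Scope ereal_scope.

(** * Resampling one coordinate *)

Section BoundedIntegrals.
Local Open Scope ring_scope.
Context d (T : measurableType d) (R : realType).

Lemma itv_integrable (mu : {measure set T -> \bar R}) (f : T -> R) (a b : R) :
  (mu setT < +oo)%E -> measurable_fun setT f ->
  (forall w, a <= f w <= b) -> mu.-integrable setT (EFin \o f).
Proof.
move=> muoo mf fab; apply: measurable_bounded_integrable => //.
exists (`|a| + `|b|); split; first exact: num_real.
move=> M /ltW abM w _; rewrite /= (le_trans _ abM)//.
have /andP[af fb] := fab w; rewrite ler_norml.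
have := ler_norm b; have := ler_norm (- a); rewrite normrN.
have := normr_ge0 a; have := normr_ge0 b; lra.
Qed.

Variable P : probability T R.

Lemma bounded_integrable (f : T -> R) (a b : R) : measurable_fun setT f ->
  (forall w, a <= f w <= b) -> P.-integrable setT (EFin \o f).
Proof.
apply: itv_integrable.
by rewrite (le_lt_trans (probability_le1 P measurableT)) ?ltry.
Qed.

Lemma Rintegral_cst1 (c : R) : \int[P]_w c = c.
Proof. by rewrite /Rintegral integral_cst//= probability_setT mule1. Qed.

Lemma Rintegral_itv (f : T -> R) (a b : R) : measurable_fun setT f ->
  (forall w, a <= f w <= b) -> a <= \int[P]_w f w <= b.
Proof.
move=> mf fab; have fi := bounded_integrable mf fab.
rewrite -[X in X <= _ <= _]Rintegral_cst1 -[X in _ <= _ <= X]Rintegral_cst1.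
have ci c : P.-integrable setT (EFin \o cst c).
  by apply: (@bounded_integrable _ c c) => // w; rewrite lexx.
apply/andP; split; apply: le_Rintegral => //; do ?[exact: ci|exact: fi].
  by move=> w _; have /andP[] := fab w.
by move=> w _; have /andP[] := fab w.
Qed.

End BoundedIntegrals.

Section Resampling.
Local Open Scope ring_scope.
Context d (T : measurableType d) (R : realType) (P : probability T R).
Variables (n : nat) (X : 'I_n -> {RV P >-> R}).

Definition joint (w : T) : n.-tuple R := [tuple X i w | i < n].

Definition upd (i : 'I_n) (x : n.-tuple R) (t : R) : n.-tuple R :=
  [tuple if j == i then t else tnth x j | j < n].

Lemma tnth_upd i x t j : tnth (upd i x t) j = if j == i then t else tnth x j.
Proof. by rewrite tnth_mktuple. Qed.

Lemma measurable_joint : measurable_fun setT joint.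
Proof.
apply/measurable_fun_tnthP => i.
by apply: (eq_measurable_fun (X i)) => // w _; rewrite /= tnth_mktuple.
Qed.

Lemma measurable_upd d' (S : measurableType d') i (f : S -> n.-tuple R)
    (g : S -> R) : measurable_fun setT f -> measurable_fun setT g ->
  measurable_fun setT (fun s => upd i (f s) (g s)).
Proof.
move=> mf mg; apply/measurable_fun_tnthP => j.
rewrite (_ : _ \o _ =
    if j == i then g else (@tnth n R ^~ j) \o f); last first.
  by apply/funext => s /=; rewrite tnth_upd; case: eqP.
case: eqP => // _; apply: measurableT_comp => //; exact: measurable_tnth.
Qed.

(** A pi-system generating the product sigma-algebra: two finite measures on tuples that agree on it
    coincide. *)
Definition boxes : set (set (n.-tuple R)) :=
  [set A | exists B : 'I_n -> set R, (forall j, measurable (B j)) /\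
    A = [set x | forall j, B j (tnth x j)]].

Lemma boxes_setI : setI_closed boxes.
Proof.
move=> _ _ [B [mB ->]] [C [mC ->]]; exists (fun j => B j `&` C j); split.
  by move=> j; exact: measurableI.
apply/seteqP; split=> x /=; first by move=> [Bx Cx] j; split.
by move=> BC; split=> j; have [] := BC j.
Qed.

Lemma boxes_measurable : boxes `<=` measurable.
Proof.
move=> _ [B [mB ->]].
rewrite (_ : mkset _ = \bigcap_(j in setT) ((@tnth n R ^~ j) @^-1` B j)).
  apply: fin_bigcap_measurable => // j _.
  by rewrite -[X in measurable X]setTI; exact: measurable_tnth.
by apply/seteqP; split=> x /= Bx j; [move=> _|]; exact: Bx.
Qed.

Lemma measurable_boxes : measurable `<=` <<s boxes >>.
Proof.
apply: smallest_sub; first exact: smallest_sigma_algebra.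
rewrite -bigcup_seq; apply: bigcup_sub => i _ A [C mC <-].
apply: sub_sigma_algebra.
exists (fun j => if j == i then C else setT).
split; first by move=> j; case: ifP.
rewrite setTI; apply/seteqP; split=> x /=.
  by move=> Cx j; case: eqP => // ->.
by move=> /(_ i); rewrite eqxx.
Qed.

Hypothesis indepX : mutually_independent X.

Lemma setX_prob_lty : ((P \x P) setT < +oo)%E.
Proof.
by rewrite -setXTT product_measure1E//= probability_setT mule1 ltry.
Qed.

(** The event on the left is a rectangle: its first side constrains the variables other than [X i],
    its second side only [X i]. Independence turns both probabilities into the same product. *)
Lemma resample_box (i : 'I_n) (B : 'I_n -> set R) :
    (forall j, measurable (B j)) ->
  ((P \x P)%E [set z | forall j, B j (tnth (upd i (joint z.1) (X i z.2)) j)] =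
  P [set w | forall j, B j (tnth (joint w) j)])%E.
Proof.
move=> mB.
have mXB j : measurable (X j @^-1` B j).
  by rewrite -[Y in measurable Y]setTI; exact: measurable_funP.
pose A := \bigcap_(j in [set` [set~ i]%SET]) (X j @^-1` B j).
have mA : measurable A by exact: fin_bigcap_measurable.
rewrite (_ : [set z | _] = A `*` (X i @^-1` B i)); last first.
  apply/seteqP; split=> -[w w'] /=.
    move=> Bz; split=> [j /=|].
      rewrite in_setC1 => /negbTE ji.
      by have := Bz j; rewrite tnth_upd ji tnth_mktuple.
    by have := Bz i; rewrite tnth_upd eqxx.
  move=> [Aw Bw'] j; rewrite tnth_upd; case: eqP => [->//|/eqP ji].
  by rewrite tnth_mktuple; apply: Aw; rewrite /= in_setC1.
rewrite product_measure1E//= /A indepX//.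
rewrite (_ : [set w | _] =
    \bigcap_(j in [set` [set: 'I_n]%SET]) (X j @^-1` B j)); last first.
  apply/seteqP; split=> w /=.
    by move=> Bw j _; have := Bw j; rewrite tnth_mktuple.
  by move=> Bw j; rewrite tnth_mktuple; apply: Bw; rewrite /= inE.
rewrite indepX// [RHS](bigD1 i) ?inE//= muleC; congr (_ * _)%E.
by apply: eq_bigl => j; rewrite !inE.
Qed.

Lemma resample_law (i : 'I_n) (A : set (n.-tuple R)) : measurable A ->
  ((P \x P)%E ((fun z => upd i (joint z.1) (X i z.2)) @^-1` A) =
  P (joint @^-1` A))%E.
Proof.
move=> mA.
have mu : measurable_fun setT (fun z : T * T => upd i (joint z.1) (X i z.2)).
  apply: measurable_upd; first exact: measurableT_comp measurable_joint _.
  exact: measurableT_comp.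
pose phi := mfun_Sub (mem_set mu : _ \in mfun).
pose psi := mfun_Sub (mem_set measurable_joint : _ \in mfun).
have := @g_sigma_algebra_measure_unique _ R _ boxes boxes_measurable
  (fun=> setT) _ _ (pushforward (P \x P)%E phi) (pushforward P psi).
apply => //.
- move=> _; exists (fun=> setT); split=> //.
  by apply/seteqP; split.
- by rewrite bigcup_const.
- exact: boxes_setI.
- by move=> _ [B [mB ->]]; exact: resample_box.
- by move=> _; rewrite /= /pushforward preimage_setT setX_prob_lty.
- exact: measurable_boxes.
Qed.

(** For independent variables, a version of the conditional expectation of [h] given all coordinates
    but the [i]-th. It stays a function of whole tuples so that averages can be iterated. *)
Definition avg (i : 'I_n) (h : n.-tuple R -> R) (x : n.-tuple R) : R :=
  \int[P]_w h (upd i x (X i w)).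

Section BoundedAverages.
Variables (h : n.-tuple R -> R) (a b : R).
Hypothesis mh : measurable_fun setT h.
Hypothesis hab : forall x, a <= h x <= b.

Lemma measurable_resampled i x :
  measurable_fun setT (fun w => h (upd i x (X i w))).
Proof. by apply: measurableT_comp => //; exact: measurable_upd. Qed.
Local Hint Resolve measurable_resampled : core.

Lemma avg_itv i x : a <= avg i h x <= b.
Proof. by apply: Rintegral_itv => // w; exact: hab. Qed.

Lemma measurable_avg i : measurable_fun setT (avg i h).
Proof.
(* Subtracting the lower bound [a] makes the integrand nonnegative, as Tonelli's theorem asks. *)
pose k := fun z : n.-tuple R * T => (h (upd i z.1 (X i z.2)) - a)%:E.
have mhk : measurable_fun setT
    (fun z : n.-tuple R * T => h (upd i z.1 (X i z.2))).
  apply: measurableT_comp => //; apply: measurable_upd => //.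
  exact: measurableT_comp.
have mk : measurable_fun setT k.
  by apply/measurable_EFinP; exact: measurable_funB.
have k0 z : (0 <= k z)%E.
  by rewrite lee_fin subr_ge0; have /andP[] := hab (upd i z.1 (X i z.2)).
have mF := @measurable_fun_fubini_tonelli_F _ _ _ _ R P k mk k0.
rewrite (_ : avg i h = (fun x => fine (\int[P]_w k (x, w))%E + a)).
  apply: measurable_funD => //.
  by apply: measurableT_comp => //; exact: mF.
apply/funext => x; rewrite /k/= -/(Rintegral P setT _) RintegralB//.
- by rewrite Rintegral_cst1 subrK.
- by apply: (@bounded_integrable _ _ _ _ _ a b) => // w; exact: hab.
- by apply: (@bounded_integrable _ _ _ _ _ a a) => // w; rewrite lexx.
Qed.

(** By Fubini the left-hand side is an integral over [P \x P] of [h] at the resampled tuple, which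
    by [resample_law] is distributed as [joint]. *)
Lemma Rintegral_avg i :
  \int[P]_w avg i h (joint w) = \int[P]_w h (joint w).
Proof.
pose g := fun z : T * T => upd i (joint z.1) (X i z.2).
have mg : measurable_fun setT g.
  apply: measurable_upd; first exact: measurableT_comp measurable_joint _.
  exact: measurableT_comp.
have hgi : (P \x P)%E.-integrable setT (EFin \o (h \o g)).
  apply: (@itv_integrable _ _ _ _ _ a b).
  - exact: setX_prob_lty.
  - exact: measurableT_comp.
  - by move=> z; exact: hab.
rewrite /Rintegral; congr fine.
transitivity (\int[P]_w \int[P]_w' (h (g (w, w')))%:E)%E.
  apply: eq_integral => w _; rewrite fineK//.
  apply: integrable_fin_num => //.
  by apply: (@bounded_integrable _ _ _ _ _ a b) => // w'; exact: hab.
rewrite (integral12_prod_meas1 hgi).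
transitivity (\int[pushforward (P \x P)%E g]_x (h x)%:E)%E.
  by rewrite integral_pushforward//; exact/measurable_EFinP.
pose psi := mfun_Sub (mem_set measurable_joint : _ \in mfun).
transitivity (\int[pushforward P psi]_x (h x)%:E)%E.
  by apply: eq_measure_integral => A mA _; exact: resample_law.
rewrite integral_pushforward//.
- exact/measurable_EFinP.
- apply: (@bounded_integrable _ _ _ _ _ a b) => [|w]; last exact: hab.
  by apply: measurableT_comp => //; exact: measurable_joint.
Qed.

End BoundedAverages.

End Resampling.

Lemma Rintegral_sum d (T : measurableType d) (R : realType)
    (mu : {measure set T -> \bar R}) (I : Type) (r : seq I) (f : I -> T -> R) :
    (forall i, mu.-integrable setT (EFin \o f i)) ->
  mu.-integrable setT (EFin \o (fun w => \sum_(i <- r) f i w)%R) /\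
  (\int[mu]_w (\sum_(i <- r) f i w) = \sum_(i <- r) \int[mu]_w f i w)%R.
Proof.
move=> fi; elim: r => [|i r [ri rE]].
  have -> : (fun w => \sum_(i <- [::]) f i w)%R = cst 0%R.
    by apply/funext => w; rewrite big_nil.
  by rewrite big_nil; split; [exact: integrable0|rewrite /Rintegral integral0].
have -> : (fun w => \sum_(j <- i :: r) f j w)%R =
    (fun w => f i w + \sum_(j <- r) f j w)%R.
  by apply/funext => w; rewrite big_cons.
rewrite big_cons RintegralD// rE; split=> //.
rewrite (_ : _ \o _ = fun w => ((f i w)%:E + (\sum_(j <- r) f j w)%:E)%E)//.
by apply: integrableD => //; exact: fi.
Qed.

(** * Subadditivity of the phi-entropy *)

Section BregmanJensen.
Local Open Scope ring_scope.
Context (R : realType).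

(** The slope [s] stands for the derivative of [phi]. *)
Definition bregman (phi s : R -> R) (u c : R) : R :=
  phi u - phi c - s c * (u - c).

(** [bc_tangent] states the joint convexity of the divergence by supporting
    planes: integrating one of them gives Jensen's inequality. *)
Record bregman_convex (phi s : R -> R) (a b : R) : Prop := BregmanConvex {
  bc_measurable : measurable_fun setT phi;
  bc_slope_measurable : measurable_fun setT s;
  bc_bounded : exists B, forall u, a <= u <= b -> `|phi u| <= B /\ `|s u| <= B;
  bc_ge0 : forall u c, a <= u <= b -> a <= c <= b -> 0 <= bregman phi s u c;
  bc_tangent : forall u0 c0, a <= u0 <= b -> a <= c0 <= b -> exists p q,
    forall u c, a <= u <= b -> a <= c <= b ->
    bregman phi s u0 c0 + p * (u - u0) + q * (c - c0) <= bregman phi s u c }.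

Variables (phi s : R -> R) (a b : R).
Hypothesis phiP : bregman_convex phi s a b.
Local Notation D := (bregman phi s).

Lemma bregman_bounded : exists M, forall u c, a <= u <= b -> a <= c <= b ->
  0 <= D u c <= M.
Proof.
have [B phiB] := bc_bounded phiP.
(* One [B] for each value of [phi], and [B * (b - a)] for the slope times an increment. *)
exists (B + B + B * (b - a)) => u c uI cI; rewrite (bc_ge0 phiP)//=.
have [/ler_normlP[_ pu] _] := phiB _ uI.
have [/ler_normlP[pc _] sB] := phiB _ cI.
have B0 : 0 <= B by exact: le_trans (normr_ge0 _) sB.
have ucI : `|u - c| <= b - a.
  by move: uI cI => /andP[? ?] /andP[? ?]; rewrite ler_norml; lra.
have : - (s c * (u - c)) <= B * (b - a).
  by rewrite (le_trans (ler_norm _))// normrN normrM ler_pM.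
rewrite /bregman; lra.
Qed.

Context d (T : measurableType d) (P : probability T R).

Definition valued_in (f : T -> R) :=
  measurable_fun setT f /\ forall w, a <= f w <= b.

Lemma valued_in_integrable f : valued_in f ->
  P.-integrable setT (EFin \o f).
Proof. by move=> [mf fI]; exact: bounded_integrable mf fI. Qed.

Lemma affine_integrable (c p q : R) (f g : T -> R) :
  P.-integrable setT (EFin \o f) -> P.-integrable setT (EFin \o g) ->
  P.-integrable setT (EFin \o (fun w => c + p * f w + q * g w)).
Proof.
move=> fi gi.
have ci : P.-integrable setT (EFin \o cst c).
  by apply: (@bounded_integrable _ _ _ _ _ c c) => // w; rewrite lexx.
rewrite (_ : _ \o _ =
  (fun w => c%:E + p%:E * (f w)%:E + q%:E * (g w)%:E)%E)//.
by apply: integrableD => //; [apply: integrableD => //|]; exact: integrableZl.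
Qed.

Lemma Rintegral_affine (c p q : R) (f g : T -> R) :
  P.-integrable setT (EFin \o f) -> P.-integrable setT (EFin \o g) ->
  \int[P]_w (c + p * f w + q * g w) =
  c + p * \int[P]_w f w + q * \int[P]_w g w.
Proof.
move=> fi gi.
have ci : P.-integrable setT (EFin \o cst c).
  by apply: (@bounded_integrable _ _ _ _ _ c c) => // w; rewrite lexx.
have Zi r h : P.-integrable setT (EFin \o h) ->
    P.-integrable setT (EFin \o (fun w => r * h w)).
  by move=> hi; rewrite (_ : _ \o _ = fun w => (r%:E * (h w)%:E)%E)//;
    exact: integrableZl.
have cpfi := @integrableD _ _ _ P _ measurableT _ _ ci (Zi p _ fi).
by rewrite RintegralD// ?RintegralD// ?RintegralZl// ?Rintegral_cst1//;
  exact: Zi.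
Qed.

Lemma measurable_bregman f g : measurable_fun setT f -> measurable_fun setT g ->
  measurable_fun setT (fun w : T => D (f w) (g w)).
Proof.
move=> mf mg; have mphi := bc_measurable phiP.
have ms := bc_slope_measurable phiP.
apply: measurable_funB.
  by apply: measurable_funB; exact: measurableT_comp.
by apply: measurable_funM; [exact: measurableT_comp|exact: measurable_funB].
Qed.

Lemma bregman_integrable f g : valued_in f -> valued_in g ->
  P.-integrable setT (EFin \o (fun w => D (f w) (g w))).
Proof.
move=> [mf fI] [mg gI]; have [M DM] := bregman_bounded.
apply: (@bounded_integrable _ _ _ _ _ 0 M); first exact: measurable_bregman.
by move=> w; exact: DM.
Qed.

Lemma phi_integrable f : valued_in f ->
  P.-integrable setT (EFin \o (fun w => phi (f w))).
Proof.
move=> [mf fI]; have [B phiB] := bc_bounded phiP.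
apply: (@bounded_integrable _ _ _ _ _ (- B) B).
  by apply: measurableT_comp => //; exact: bc_measurable phiP.
by move=> w; rewrite -ler_norml; have [] := phiB _ (fI w).
Qed.

(** Integrate the plane supporting the divergence at the pair of means: its linear terms have
    integral 0. *)
Lemma bregman_jensen f g : valued_in f -> valued_in g ->
  D (\int[P]_w f w) (\int[P]_w g w) <= \int[P]_w D (f w) (g w).
Proof.
move=> fI gI; set F := Rintegral _ _ f; set G := Rintegral _ _ g.
have FI : a <= F <= b by case: fI; exact: Rintegral_itv.
have GI : a <= G <= b by case: gI; exact: Rintegral_itv.
have [p [q tgt]] := bc_tangent phiP FI GI.
have fi := valued_in_integrable fI; have gi := valued_in_integrable gI.
have <- : \int[P]_w (D F G - p * F - q * G + p * f w + q * g w) = D F G.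
  by rewrite Rintegral_affine// -/F -/G; lra.
apply: le_Rintegral => //.
- exact: affine_integrable.
- exact: bregman_integrable.
- move=> w _; have := tgt (f w) (g w) (fI.2 w) (gI.2 w); lra.
Qed.

(** The right-hand side exceeds the left-hand side by exactly [D F c], where [F] is the mean of
    [f]. *)
Lemma phi_gap_le f c : valued_in f -> a <= c <= b ->
  \int[P]_w phi (f w) - phi (\int[P]_w f w) <= \int[P]_w D (f w) c.
Proof.
move=> fI cI; set F := Rintegral _ _ f.
have FI : a <= F <= b by case: fI; exact: Rintegral_itv.
have -> : \int[P]_w D (f w) c =
    \int[P]_w (s c * c - phi c + 1 * phi (f w) + (- s c) * f w).
  by apply: eq_Rintegral => w _; rewrite /bregman; lra.
rewrite Rintegral_affine//; last 2 first.
- exact: phi_integrable.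
- exact: valued_in_integrable.
have := bc_ge0 phiP FI cI; rewrite -/F /bregman; lra.
Qed.

End BregmanJensen.

Section Subadditivity.
Local Open Scope ring_scope.
Context d (T : measurableType d) (R : realType) (P : probability T R).
Variables (n : nat) (X : 'I_n -> {RV P >-> R}).
Hypothesis indepX : mutually_independent X.
Variables (phi s : R -> R) (a b : R).
Hypothesis phiP : bregman_convex phi s a b.
Local Notation D := (bregman phi s).
Local Notation E := (n.-tuple R).
Local Notation joint := (joint X).
Local Notation avg := (avg X).
Local Notation valued := (@valued_in R a b _ E).

(** [A] collects the coordinates that [h] ignores. *)
Definition depends_off (A : pred 'I_n) (h : E -> R) :=
  forall x y : E, (forall j, ~~ A j -> tnth x j = tnth y j) -> h x = h y.

Lemma depends_off_avg (A : pred 'I_n) i h : depends_off A h ->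
  depends_off (predU1 i A) (avg i h).
Proof.
move=> Ah x y xy; apply: eq_Rintegral => w _; apply: Ah => j jA.
by rewrite !tnth_upd; case: eqP => // /eqP ji; apply: xy; rewrite /= negb_or ji.
Qed.

Lemma avg_valued i h : valued h -> valued (avg i h).
Proof.
by move=> [mh hI]; split; [exact: measurable_avg mh hI i|exact: avg_itv].
Qed.

Lemma valued_joint h : valued h -> valued_in a b (h \o joint).
Proof.
move=> [mh hI]; split=> [|w]; last exact: hI.
by apply: measurableT_comp => //; exact: measurable_joint.
Qed.

Lemma avg_joint_integrable (h : E -> R) (a' b' : R) : measurable_fun setT h ->
  (forall x, a' <= h x <= b') -> forall i,
  P.-integrable setT (EFin \o (fun w => avg i h (joint w))).
Proof.
move=> mh hI i; apply: (@bounded_integrable _ _ _ _ _ a' b') => [|w].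
  apply: measurableT_comp; first exact: measurable_avg mh hI i.
  exact: measurable_joint.
exact: avg_itv.
Qed.

Lemma valued_upd i x h : valued h ->
  valued_in a b (fun w => h (upd i x (X i w))).
Proof.
move=> [mh hI]; split=> [|w]; last exact: hI.
exact: measurable_resampled mh i x.
Qed.

Lemma phi_valued h : valued h -> exists B, @valued_in R (- B) B _ E (phi \o h).
Proof.
move=> [mh hI]; have [B phiB] := bc_bounded phiP; exists B; split.
  by apply: measurableT_comp => //; exact: bc_measurable phiP.
by move=> x; rewrite -ler_norml; have [] := phiB _ (hI x).
Qed.

Lemma bregman_valued f g : valued f -> valued g ->
  exists M, @valued_in R 0 M _ E (fun x => D (f x) (g x)).
Proof.
move=> [mf fI] [mg gI]; have [M DM] := bregman_bounded phiP.
exists M; split=> [|x]; last exact: DM.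
exact: measurable_bregman phiP _ _ _ _ mf mg.
Qed.

(** This is [phi_gap_le] with all coordinates but the [i]-th frozen, then integrated: along
    coordinate [i] the function [g] is a constant. *)
Lemma gap_avg_le i f g : valued f -> valued g -> depends_off (pred1 i) g ->
  \int[P]_w phi (f (joint w)) - \int[P]_w phi (avg i f (joint w)) <=
  \int[P]_w D (f (joint w)) (g (joint w)).
Proof.
move=> fI gI gi.
have [B [mpf pfB]] := phi_valued fI.
have [M [mD DM]] := bregman_valued fI gI.
rewrite -(Rintegral_avg indepX mpf pfB i) -(Rintegral_avg indepX mD DM i).
rewrite -RintegralB//; last 2 first.
- exact: avg_joint_integrable mpf pfB i.
- exact: phi_integrable phiP _ _ _ _ (valued_joint (avg_valued i fI)).
apply: le_Rintegral => //.
- rewrite (_ : _ \o _ = (fun w =>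
    (avg i (phi \o f) (joint w))%:E - (phi (avg i f (joint w)))%:E)%E)//.
  apply: integrableB => //; first exact: avg_joint_integrable mpf pfB i.
  exact: phi_integrable phiP _ _ _ _ (valued_joint (avg_valued i fI)).
- exact: avg_joint_integrable mD DM i.
move=> w _; rewrite [leRHS](_ : _ =
  \int[P]_w' D (f (upd i (joint w) (X i w'))) (g (joint w))).
  exact: (phi_gap_le phiP P (valued_upd i (joint w) fI) (gI.2 _)).
apply: eq_Rintegral => w' _; congr D; apply: gi => j /= /negbTE ji.
by rewrite tnth_upd ji.
Qed.

(** Jensen's inequality conditionally on the coordinates other than [i]. *)
Lemma bregman_avg_le i f g : valued f -> valued g ->
  \int[P]_w D (avg i f (joint w)) (avg i g (joint w)) <=
  \int[P]_w D (f (joint w)) (g (joint w)).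
Proof.
move=> fI gI; have [M [mD DM]] := bregman_valued fI gI.
rewrite -(Rintegral_avg indepX mD DM i); apply: le_Rintegral => //.
- exact: (bregman_integrable phiP _ (valued_joint (avg_valued i fI))
    (valued_joint (avg_valued i gI))).
- exact: avg_joint_integrable mD DM i.
move=> w _.
exact: (bregman_jensen phiP P (valued_upd i _ fI) (valued_upd i _ gI)).
Qed.

Definition avgs (l : seq 'I_n) (f : E -> R) := foldl (fun h i => avg i h) f l.

(** The left-hand side telescopes along [l]. After one step the induction hypothesis is used for the
    averages of [f] and of all the [g j], and [bregman_avg_le] brings its divergences back to the
    original functions. *)
Lemma gap_avgs_le l f g : valued f -> (forall i, valued (g i)) ->
    (forall i, depends_off (pred1 i) (g i)) ->
  \int[P]_w phi (f (joint w)) - \int[P]_w phi (avgs l f (joint w)) <=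
  \sum_(i <- l) \int[P]_w D (f (joint w)) (g i (joint w)).
Proof.
elim: l f g => [|i l IHl] f g fI gI gi; first by rewrite big_nil subrr.
rewrite big_cons /=.
have step := gap_avg_le fI (gI i) (gi i).
have := IHl (avg i f) (fun j => avg i (g j)) (avg_valued i fI)
  (fun j => avg_valued i (gI j)).
have di j : depends_off (pred1 j) (avg i (g j)).
  move=> x y xy; apply: (depends_off_avg (gi j)) => k /=.
  by rewrite negb_or => /andP[_ kj]; exact: xy.
move=> /(_ di) IH.
have : \sum_(j <- l) \int[P]_w D (avg i f (joint w)) (avg i (g j) (joint w)) <=
    \sum_(j <- l) \int[P]_w D (f (joint w)) (g j (joint w)).
  by apply: ler_sum => j _; exact: bregman_avg_le.
by move: step IH; lra.
Qed.

Lemma Rintegral_avgs l f : valued f ->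
  \int[P]_w avgs l f (joint w) = \int[P]_w f (joint w).
Proof.
elim: l f => //= i l IHl f fI; rewrite IHl//; last exact: avg_valued.
by case: fI => mf ab_f; exact: (Rintegral_avg indepX mf ab_f).
Qed.

Lemma depends_off_avgs (A : pred 'I_n) l f : depends_off A f ->
  depends_off (predU A (mem l)) (avgs l f).
Proof.
elim: l A f => [|i l IHl] A f Af /=.
  by move=> x y xy; apply: Af => j jA; apply: xy; rewrite /= orbF.
move=> x y xy; apply: (IHl _ _ (depends_off_avg Af)) => j /= ij.
by apply: xy; move: ij; rewrite /= inE; case: (j == i); case: (A j).
Qed.

Theorem phi_entropy_subadditive f (g : 'I_n -> E -> R) : valued f ->
    (forall i, valued (g i)) -> (forall i, depends_off (pred1 i) (g i)) ->
  \int[P]_w phi (f (joint w)) - phi (\int[P]_w f (joint w)) <=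
  \sum_(i < n) \int[P]_w D (f (joint w)) (g i (joint w)).
Proof.
move=> fI gI gi; have := gap_avgs_le (index_enum 'I_n) fI gI gi.
set F := avgs _ f; set x0 : E := [tuple 0 | i < n].
(* Once every coordinate is averaged out, [F] is constant, equal to the mean of [f]; [x0] is an
   arbitrary point at which to read it. *)
have FE x : F x = F x0.
  have : depends_off pred0 f.
    by move=> u v uv; congr f; apply: eq_from_tnth => j; exact: uv.
  move=> /(depends_off_avgs (l := index_enum 'I_n)); apply => j /=.
  by rewrite mem_index_enum.
under [X in _ - X <= _ -> _]eq_Rintegral do rewrite FE.
rewrite Rintegral_cst1 -(Rintegral_avgs (index_enum 'I_n) fI) -/F.
under [in X in _ -> _ - X <= _]eq_Rintegral do rewrite FE.
by rewrite Rintegral_cst1.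
Qed.

End Subadditivity.

(** * Order statistics of the sample deprived of one variable *)

Section OrderStatistics.
Local Open Scope ring_scope.
Context (R : realType).

(** Reduces every question about order statistics to counting entries above a threshold, which also
    handles ties. *)
Lemma le_nth_sort (s : seq R) m t : (m < size s)%N ->
  (t <= nth 0 (sort >=%R s) m) = (m < count (>= t) s)%N.
Proof.
have /seq.permP <- : perm_eq (sort >=%R s) s by rewrite perm_sort.
rewrite -(size_sort >=%R).
have : sorted >=%R (sort >=%R s).
  by apply: sort_sorted => x y; exact: le_total.
elim: (sort _ s) m => //= x l IHl m xl.
(* The head is the largest entry, so if it misses [t] all the others do. *)
have ltx : t <= x = false -> count (>= t) l = 0%N.
  move=> /negbT; rewrite -ltNge => xt; apply/eqP; rewrite eqn0Ngt -has_count.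
  apply/hasPn => y yl; rewrite -ltNge; apply: le_lt_trans xt.
  have /allP := order_path_min (rev_trans le_trans) xl.
  exact.
case: m => [_|m ml] /=.
  by case: (boolP (t <= x)) => [//|/negbTE/ltx ->].
rewrite IHl//; last exact: path_sorted xl.
by case: (boolP (t <= x)) => [//|/negbTE/ltx ->]; rewrite add0n.
Qed.

Lemma eq_lower_bounds (u v : R) : (forall t, (t <= u) = (t <= v)) -> u = v.
Proof. by move=> uv; apply/le_anti; rewrite -uv lexx uv lexx. Qed.

Variable n : nat.
Implicit Types (l : seq 'I_n) (x : n.-tuple R).

(** Ranks count from 0 here, while [order_stat] counts from 1. *)
Definition ostat l m x : R := nth 0 (sort >=%R [seq tnth x i | i <- l]) m.

Definition nb_ge l t x : nat := count (fun i => t <= tnth x i) l.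

Lemma le_ostat l m x t : (m < size l)%N ->
  (t <= ostat l m x) = (m < nb_ge l t x)%N.
Proof.
by move=> ml; rewrite /ostat le_nth_sort ?size_map// count_map.
Qed.

Lemma measurable_nb_ge l t m : measurable [set x | (m < nb_ge l t x)%N].
Proof.
elim: l m => [|i l IHl] m.
  by rewrite (_ : mkset _ = set0)// -subset0 => x.
have mi : measurable [set x : n.-tuple R | t <= tnth x i].
  rewrite (_ : mkset _ = (@tnth n R ^~ i) @^-1` `[t, +oo[).
    by rewrite -[Y in measurable Y]setTI; exact: measurable_tnth.
  by apply/seteqP; split=> x /=; rewrite in_itv/= andbT.
have ml : measurable [set x | (m <= nb_ge l t x)%N].
  case: m => [|m]; last exact: IHl.
  by rewrite (_ : mkset _ = setT)//; apply/seteqP; split.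
(* Either entry [i] counts and [m] others suffice, or the tail alone has more than [m]. *)
rewrite (_ : mkset _ = ([set x : n.-tuple R | t <= tnth x i] `&`
    [set x | (m <= nb_ge l t x)%N]) `|` [set x | (m < nb_ge l t x)%N]).
  by apply: measurableU => //; exact: measurableI.
apply/seteqP; split=> x; rewrite /nb_ge /=.
  by case: (t <= _) => /=; [left|right].
by case=> [[-> //]|/leq_trans]; apply; exact: leq_addl.
Qed.

Lemma measurable_ostat l m : (m < size l)%N -> measurable_fun setT (ostat l m).
Proof.
move=> ml; apply: (measurability (@RGenCInfty.G R)).
  exact: RGenCInfty.measurableE.
move=> /= _ [_ [t ->] <-]; rewrite setTI.
rewrite (_ : _ @^-1` _ = [set x | (m < nb_ge l t x)%N]).
  exact: measurable_nb_ge.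
by apply/seteqP; split=> x /=; rewrite in_itv/= andbT le_ostat.
Qed.

Local Notation all_ := (enum 'I_n).

Lemma nb_ge_rem i t x :
  nb_ge all_ t x = ((t <= tnth x i)%R + nb_ge (seq.rem i all_) t x)%N.
Proof. by rewrite /nb_ge (seq.permP (perm_to_rem (mem_enum 'I_n i))). Qed.

(** Both sides are compared through the thresholds [t] below them. Removing an entry at or above the
    one of rank [m] shifts the ranks by one; removing a smaller entry leaves rank [m] in place. *)
Lemma ostat_rem i m x : (m.+1 < n)%N ->
  ostat (seq.rem i all_) m x =
  if ostat all_ m x <= tnth x i then ostat all_ m.+1 x else ostat all_ m x.
Proof.
move=> mn; have sz : size all_ = n by rewrite size_enum_ord.
have le_v k t : (k < n)%N -> (t <= ostat all_ k x) = (k < nb_ge all_ t x)%N.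
  by move=> kn; rewrite le_ostat// sz.
have mn' : (m < n)%N by exact: ltnW.
apply: eq_lower_bounds => t; rewrite le_ostat; last first.
  by rewrite size_rem ?mem_enum// sz; case: (n) mn => // -[].
have := nb_ge_rem i t x.
case: ifPn => [vx|]; last rewrite -ltNge => xv.
- rewrite le_v//; have [tx ->//|xt CE] := leP t (tnth x i).
  (* Here [t] exceeds the value of rank [m], so at most [m] entries reach it and both sides are
     false. *)
  have : ~~ (t <= ostat all_ m x) by rewrite -ltNge (le_lt_trans vx).
  rewrite le_v// CE add0n -leqNgt => cm.
  by rewrite ltnNge cm ltnNge (leqW cm).
- rewrite le_v//; have [tx ->|xt ->//] := leP t (tnth x i).
  (* More than [m] entries reach the value of rank [m]; entry [i] is not among them and all of them
     reach [t], so both sides are true. *)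
  have := le_v m (ostat all_ m x) mn'.
  rewrite lexx (nb_ge_rem i) [_ <= tnth x i]leNgt xv add0n.
  move=> /esym mc.
  have : (m < nb_ge (seq.rem i all_) t x)%N.
    apply: leq_trans mc _; apply: sub_count => j; apply: le_trans.
    by rewrite (le_trans tx)// ltW.
  by move=> mc'; rewrite mc' add1n ltnS ltnW.
Qed.

Section LeaveOneOutSums.
Variables (K : R -> R -> R) (m : nat) (x : n.-tuple R).
Hypotheses (K0 : forall u, K u u = 0) (K_ge0 : forall u v, 0 <= K u v).
Hypothesis mn : (m.+1 < n)%N.
Local Notation v k := (ostat all_ k x).

Lemma sum_if (P : pred 'I_n) (c : R) :
  \sum_(i < n) (if P i then c else 0) = (count P all_)%:R * c.
Proof.
rewrite -big_mkcond/= sumr_const mulr_natl; congr (_ *+ _).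
by rewrite cardE size_filter enumT.
Qed.

(** Only indices whose entry is at least [v m] contribute. If [v m] differs from [v m.+1] there are
    at most [m.+1] of them; if the two are tied, [K] vanishes. *)
Lemma sum_leave_one_out_top :
  \sum_(i < n) K (v m) (ostat (seq.rem i all_) m x) <=
  m.+1%:R * K (v m) (v m.+1).
Proof.
under eq_bigr do rewrite ostat_rem// (fun_if (K (v m))) K0.
rewrite sum_if -/(nb_ge all_ (v m) x).
have [<-|nvv] := eqVneq (v m) (v m.+1); first by rewrite K0 !mulr0.
apply: ler_wpM2r => //; rewrite ler_nat leqNgt -le_ostat ?size_enum_ord//.
apply/negP => vv; move/eqP: nvv; apply; apply/le_anti; rewrite vv/=.
by rewrite le_ostat ?size_enum_ord ?(ltnW mn)// ltnW// -le_ostat ?size_enum_ord.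
Qed.

(** Only indices whose entry is below [v m] contribute, and at least [m.+1] entries reach [v m]. *)
Lemma sum_leave_one_out_bottom :
  \sum_(i < n) K (v m.+1) (ostat (seq.rem i all_) m x) <=
  (n - m.+1)%:R * K (v m.+1) (v m).
Proof.
under eq_bigr do rewrite ostat_rem// (fun_if (K (v m.+1))) K0 -if_neg.
rewrite sum_if; apply: ler_wpM2r => //; rewrite ler_nat.
have mC : (m < nb_ge all_ (v m) x)%N.
  by rewrite -le_ostat ?size_enum_ord// ltnW.
have := count_predC (fun i => v m <= tnth x i) all_.
rewrite size_enum_ord => nE; rewrite leq_subRL; last exact: ltnW.
by rewrite -[leqRHS]nE leq_add2r; exact: mC.
Qed.

End LeaveOneOutSums.

End OrderStatistics.

Lemma order_statE d (T : measurableType d) (R : realType) (P : probability T R)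
    (n : nat) (X : 'I_n -> {RV P >-> R}) k w :
  order_stat X k w = ostat (enum 'I_n) k.-1 (joint X w).
Proof.
by rewrite /order_stat /ostat; under [in RHS]eq_map do rewrite tnth_mktuple.
Qed.

(** * The inequality for bounded functions of an order statistic *)

Section OrderStatisticGap.
Local Open Scope ring_scope.
Context d (T : measurableType d) (R : realType) (P : probability T R).
Variables (n : nat) (X : 'I_n -> {RV P >-> R}).
Hypothesis indepX : mutually_independent X.
Variables (phi s theta : R -> R) (a b : R).
Hypothesis phiP : bregman_convex phi s a b.
Hypothesis mtheta : measurable_fun setT theta.
Hypothesis theta_itv : forall z, a <= theta z <= b.
Local Notation all_ := (enum 'I_n).
Local Notation joint := (joint X).
Local Notation D := (bregman phi s).

Lemma valued_ostat l m : (m < size l)%N ->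
  @valued_in R a b _ (n.-tuple R) (theta \o ostat l m).
Proof.
move=> ml; split=> [|x]; last exact: theta_itv.
by apply: measurableT_comp => //; exact: measurable_ostat.
Qed.

Lemma depends_off_ostat_rem i m (h : R -> R) :
  depends_off (pred1 i) (h \o ostat (seq.rem i all_) m).
Proof.
move=> x y xy /=; congr (h (nth _ (sort _ _) _)).
apply/eq_in_map => j; rewrite mem_rem_uniq ?enum_uniq// !inE => /andP[ji _].
exact: xy.
Qed.

Lemma measurable_ostat_joint m : (m < n)%N ->
  measurable_fun setT (fun w => ostat all_ m (joint w)).
Proof.
move=> mn; apply: measurableT_comp (measurable_joint X).
by apply: measurable_ostat; rewrite size_enum_ord.
Qed.

Variables (m p q : nat) (c : R).
Hypotheses (mn : (m.+1 < n)%N) (pn : (p < n)%N) (qn : (q < n)%N).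
Hypothesis c_ge0 : 0 <= c.
Hypothesis leave_one_out : forall (K : R -> R -> R) x,
  (forall u, K u u = 0) -> (forall u v, 0 <= K u v) ->
  \sum_(i < n) K (ostat all_ p x) (ostat (seq.rem i all_) m x) <=
  c * K (ostat all_ p x) (ostat all_ q x).

(** Common to both halves of the theorem: [p] is the rank of the order statistic, [q] that of its
    neighbour, [m] the rank read in the reduced samples. The map [theta] truncates, while [K] may be
    chosen free of the truncation level, which makes the bound uniform in it. *)
Lemma ostat_gap_le (K : R -> R -> R) :
  measurable_fun setT
    (fun w => K (ostat all_ p (joint w)) (ostat all_ q (joint w))) ->
  (forall u v, D (theta u) (theta v) <= K u v) ->
  ((\int[P]_w phi (theta (ostat all_ p (joint w))) -
    phi (\int[P]_w theta (ostat all_ p (joint w))))%:E <=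
  c%:E * \int[P]_w (K (ostat all_ p (joint w)) (ostat all_ q (joint w)))%:E)%E.
Proof.
move=> mK DK.
have sz : size all_ = n by rewrite size_enum_ord.
have vp : @valued_in R a b _ (n.-tuple R) (theta \o ostat all_ p).
  by apply: valued_ostat; rewrite sz.
have vq : @valued_in R a b _ (n.-tuple R) (theta \o ostat all_ q).
  by apply: valued_ostat; rewrite sz.
have vr i : @valued_in R a b _ (n.-tuple R) (theta \o ostat (seq.rem i all_) m).
  apply: valued_ostat; rewrite size_rem ?mem_enum// sz.
  by rewrite -ltnS (ltn_predK mn).
pose Z k := fun w => theta (ostat all_ k (joint w)).
pose Zi i := fun w => theta (ostat (seq.rem i all_) m (joint w)).
have := phi_entropy_subadditive indepX phiP vp vr
  (fun i => @depends_off_ostat_rem i m theta).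
rewrite /= => gap.
have D_ge0 u v : 0 <= D (theta u) (theta v) by exact: (bc_ge0 phiP).
have ipi i : P.-integrable setT (EFin \o (fun w => D (Z p w) (Zi i w))).
  exact: (bregman_integrable phiP _ (valued_joint X vp)
    (valued_joint X (vr i))).
have ipq : P.-integrable setT (EFin \o (fun w => D (Z p w) (Z q w))).
  exact: (bregman_integrable phiP _ (valued_joint X vp) (valued_joint X vq)).
apply: (@le_trans _ _ (\sum_(i < n) \int[P]_w D (Z p w) (Zi i w))%:E).
  by rewrite lee_fin.
(* The counting bound is applied pointwise to the bounded divergence. [K] enters afterwards, in the
   extended reals, since its integral may be infinite. *)
apply: (@le_trans _ _ (c * \int[P]_w D (Z p w) (Z q w))%:E).
  rewrite lee_fin -RintegralZl//.
  have [spi <-] := Rintegral_sum (index_enum 'I_n) ipi.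
  apply: le_Rintegral => //.
    by rewrite (_ : _ \o _ = fun w => (c%:E * (D (Z p w) (Z q w))%:E)%E)//;
      exact: integrableZl.
  move=> w _.
  apply: (leave_one_out (K := fun u v => D (theta u) (theta v))) => // u.
  by rewrite /bregman !subrr mulr0 subr0.
rewrite EFinM fineK; last exact: integrable_fin_num.
apply: lee_wpmul2l; first by rewrite lee_fin.
apply: ge0_le_integral => //.
- by move=> w _; rewrite lee_fin; exact: D_ge0.
- by apply/measurable_EFinP; exact: (measurable_bregman phiP
    (valued_joint X vp).1 (valued_joint X vq).1).
- exact/measurable_EFinP.
- by move=> w _; rewrite lee_fin; exact: DK.
Qed.

End OrderStatisticGap.

(** * Removing the truncation in the limit *)

Section Limits.
Local Open Scope ring_scope.
Context d (T : measurableType d) (R : realType) (P : probability T R).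

Lemma dominated_Rintegral (f_ : nat -> T -> R) (f g : T -> R) :
  (forall N, measurable_fun setT (f_ N)) -> measurable_fun setT f ->
  (forall w, f_ ^~ w @ \oo --> f w) ->
  P.-integrable setT (EFin \o g) -> (forall N w, `|f_ N w| <= g w) ->
  P.-integrable setT (EFin \o f) /\
  \int[P]_w f_ N w @[N --> \oo] --> \int[P]_w f w.
Proof.
move=> mf_ mf f_f gi fg.
have [|||||fi _ fcvg] := @dominated_convergence _ _ _ P setT measurableT
  (fun N => EFin \o f_ N) (EFin \o f) (EFin \o g).
- by move=> N; exact/measurable_EFinP.
- exact/measurable_EFinP.
- by apply: aeW => w _; apply: cvg_EFin; [exact: nearW|exact: f_f].
- exact: gi.
- by apply: aeW => w N _ /=; rewrite lee_fin.
split=> //; apply: fine_cvg; rewrite fineK//; exact: integrable_fin_num.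
Qed.

(** Dominated convergence is used for [Z_ N] and for [phi] of it, both being eventually constant in
    [N] at each point; continuity of [phi] at the limit mean handles the second term. *)
Lemma gap_limit (phi : R -> R) (Z_ : nat -> T -> R) (Z g h : T -> R)
    (C : \bar R) :
  measurable_fun setT phi ->
  (forall N, measurable_fun setT (Z_ N)) -> measurable_fun setT Z ->
  (forall w, \forall N \near \oo, Z_ N w = Z w) ->
  P.-integrable setT (EFin \o g) -> (forall N w, `|Z_ N w| <= g w) ->
  P.-integrable setT (EFin \o h) -> (forall N w, `|phi (Z_ N w)| <= h w) ->
  {for \int[P]_w Z w, continuous phi} ->
  (forall N, (\int[P]_w phi (Z_ N w) - phi (\int[P]_w Z_ N w))%:E <= C)%E ->
  ((\int[P]_w phi (Z w) - phi (\int[P]_w Z w))%:E <= C)%E.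
Proof.
move=> mphi mZ_ mZ Z_Z gi Zg hi phih cphi gap.
have [_ cZ] := dominated_Rintegral mZ_ mZ
  (fun w => cvg_near_cst _ (Z_Z w)) gi Zg.
have [] :=
  @dominated_Rintegral (fun N => phi \o Z_ N) (phi \o Z) h _ _ _ hi phih.
- by move=> N; exact: measurableT_comp.
- exact: measurableT_comp.
- by move=> w; apply: cvg_near_cst; apply: filterS (Z_Z w) => N /= ->.
move=> _ cphiZ.
have cgap : \int[P]_w phi (Z_ N w) - phi (\int[P]_w Z_ N w) @[N --> \oo] -->
    \int[P]_w phi (Z w) - phi (\int[P]_w Z w).
  by apply: cvgB => //; exact: continuous_cvg.
case: C gap => [C||] gap; [|exact: leey|by have := gap 0%N].
rewrite lee_fin; apply: cvgr_to_le cgap _; apply: nearW => N.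
by have := gap N; rewrite lee_fin.
Qed.

End Limits.

(** * Truncation *)

Section Clamping.
Local Open Scope ring_scope.
Context (R : realType).

Definition clamp (N : nat) (z : R) : R := Num.max (- N%:R) (Num.min N%:R z).

Lemma clamp_itv N z : - N%:R <= clamp N z <= N%:R.
Proof.
rewrite /clamp le_max lexx/= ge_max ge_min lexx/= andbT.
by rewrite (le_trans _ (ler0n _ N))// lerNl oppr0.
Qed.

Lemma measurable_clamp N : measurable_fun setT (clamp N).
Proof. by apply: measurable_maxr => //; exact: measurable_minr. Qed.

Lemma clamp_between N z : (0 <= clamp N z <= z) || (z <= clamp N z <= 0).
Proof.
have N0 : (0 : R) <= N%:R by exact: ler0n.
rewrite /clamp; have [Nz|zN] := leP (N%:R : R) z.
  by rewrite (max_idPr _); lra.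
have [Nz|zN'] := leP (- N%:R) z; last by apply/orP; right; lra.
by apply/orP; have [z0|z0] := leP 0 z; [left|right]; lra.
Qed.

Lemma clamp_near z : \forall N \near \oo, clamp N z = z.
Proof.
near=> N; have : `|z| <= N%:R by near: N; exact: nbhs_infty_ger.
rewrite ler_norml => /andP[Nz zN].
by rewrite /clamp (min_idPr zN) (max_idPr Nz).
Unshelve. all: by end_near. Qed.

Lemma clamp_norm_le N z : `|clamp N z| <= `|z|.
Proof.
by case/orP: (clamp_between N z) => /andP[h1 h2];
  [rewrite !ger0_norm|rewrite !ler0_norm]; lra.
Qed.

Lemma expR_clamp_le N z : expR (clamp N z) <= expR z + 1.
Proof.
have ez := expR_ge0 z.
case/orP: (clamp_between N z) => /andP[h1 h2].
  by rewrite (@le_trans _ _ (expR z)) ?ler_expR// lerDl.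
by rewrite (@le_trans _ _ 1) ?lerDr// -expR0 ler_expR.
Qed.

Lemma clamp_expR_le N z :
  `|clamp N z| * expR (clamp N z) <= `|z| * expR z + 1.
Proof.
case/orP: (clamp_between N z) => /andP[h1 h2].
  rewrite (@le_trans _ _ (`|z| * expR z)) ?lerDl// ler_pM ?expR_ge0//.
    exact: clamp_norm_le.
  by rewrite ler_expR.
(* For a clamped value y <= 0, the bound -y e^y <= 1 follows from e^(-y) >= 1 - y. *)
rewrite (@le_trans _ _ 1) ?lerDr ?mulr_ge0 ?expR_ge0//.
rewrite ler0_norm// -ler_pdivlMr ?expR_gt0// mul1r -expRN.
by rewrite (le_trans _ (expR_ge1Dx _))// lerDr.
Qed.

Section Contraction.
Variable K : R -> R -> R.
Hypotheses (K0 : forall u, K u u = 0) (K_ge0 : forall u v, 0 <= K u v).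
Hypothesis K_mid : forall u z v, (u <= z <= v) || (v <= z <= u) ->
  K u z <= K u v /\ K z v <= K u v.

(** Clamping is a minimum followed by a maximum. Each of them fixes both arguments, or merges them
    so that [K] vanishes, or moves one of them to a point between the two, where [K_mid] applies. *)
Lemma clamp_contract N u v : K (clamp N u) (clamp N v) <= K u v.
Proof.
have minK M u' v' : K (Num.min M u') (Num.min M v') <= K u' v'.
  have [Mu|uM] := leP M u'; have [Mv|vM] := leP M v'; rewrite ?K0//.
  - by have [] := @K_mid u' M v' _; rewrite ?Mu ?(ltW vM) ?orbT.
  - by have [] := @K_mid u' M v' _; rewrite ?Mv ?(ltW uM).
have maxK M u' v' : K (Num.max M u') (Num.max M v') <= K u' v'.
  have [Mu|uM] := leP M u'; have [Mv|vM] := leP M v'; rewrite ?K0//.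
  - by have [] := @K_mid u' M v' _; rewrite ?Mu ?(ltW vM) ?orbT.
  - by have [] := @K_mid u' M v' _; rewrite ?Mv ?(ltW uM).
exact: le_trans (maxK _ _ _) (minK _ _ _).
Qed.

End Contraction.
End Clamping.

(** * The divergences of y^2 and y log y *)

Section Kernels.
Local Open Scope ring_scope.
Context (R : realType).
Implicit Types a b u v c z : R.

Lemma itv_norm_le a b u : a <= u <= b -> `|u| <= `|a| + `|b|.
Proof.
move=> /andP[au ub]; rewrite ler_norml.
have := ler_norm b; have := ler_norm (- a); rewrite normrN.
have := normr_ge0 a; have := normr_ge0 b; lra.
Qed.

Definition sqr_slope u : R := 2 * u.

Lemma bregman_sqr u v : bregman (fun z => z ^+ 2) sqr_slope u v = (u - v) ^+ 2.
Proof. by rewrite /bregman /sqr_slope; ring. Qed.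

Lemma sqr_bregman_convex a b : bregman_convex (fun z => z ^+ 2) sqr_slope a b.
Proof.
split.
- exact: measurable_funX.
- exact: measurable_funM.
- pose M := `|a| + `|b|; exists (M ^+ 2 + 2 * M) => u /itv_norm_le uM.
  have M0 : 0 <= M by rewrite addr_ge0.
  split.
    rewrite normrX (@le_trans _ _ (M ^+ 2)) ?lerXn2r ?nnegrE//.
    by rewrite lerDl mulr_ge0.
  rewrite normrM ger0_norm// (@le_trans _ _ (2 * M)) ?ler_wpM2l// lerDr.
  exact: exprn_ge0.
- by move=> u c _ _; rewrite bregman_sqr sqr_ge0.
(* The gradient of (u - c)^2 at (u0, c0). *)
- move=> u0 c0 _ _; exists (2 * (u0 - c0)), (- (2 * (u0 - c0))) => u c _ _.
  rewrite !bregman_sqr -subr_ge0.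
  rewrite (_ : _ - _ = ((u - c) - (u0 - c0)) ^+ 2) ?sqr_ge0//; ring.
Qed.

Definition xlnx u : R := u * ln u.

Definition xlnx_slope u : R := ln u + 1.

Lemma bregman_xlnx u c :
  bregman xlnx xlnx_slope u c = u * (ln u - ln c) - u + c.
Proof. by rewrite /bregman /xlnx /xlnx_slope; ring. Qed.

(** The divergence of y log y in logarithmic coordinates, see [bregman_expR]. *)
Definition exp_div p q : R := expR p * (p - q - 1) + expR q.

Lemma bregman_expR p q :
  bregman xlnx xlnx_slope (expR p) (expR q) = exp_div p q.
Proof. by rewrite bregman_xlnx !expRK /exp_div; ring. Qed.

Lemma exp_div_id p : exp_div p p = 0.
Proof. by rewrite /exp_div; ring. Qed.

Lemma exp_div_ge0 p q : 0 <= exp_div p q.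
Proof.
have -> : exp_div p q = expR p * (expR (q - p) - (1 + (q - p))).
  by rewrite mulrBr -expRD (addrC p (q - p)) subrK /exp_div; ring.
by rewrite mulr_ge0 ?expR_ge0// subr_ge0 expR_ge1Dx.
Qed.

(** The three-point identity of Bregman divergences: the cross term is nonnegative for an
    intermediate [z] because exp is increasing. *)
Lemma exp_div_mid p z q : (p <= z <= q) || (q <= z <= p) ->
  exp_div p z <= exp_div p q /\ exp_div z q <= exp_div p q.
Proof.
move=> pzq.
have -> : exp_div p q = exp_div p z + exp_div z q + (z - q) * (expR p - expR z).
  by rewrite /exp_div; ring.
have : 0 <= (z - q) * (expR p - expR z).
  case/orP: pzq => /andP[h1 h2].
    by rewrite -mulrNN mulr_ge0// opprB subr_ge0// ler_expR.
  by rewrite mulr_ge0// subr_ge0// ler_expR.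
have := exp_div_ge0 p z; have := exp_div_ge0 z q; lra.
Qed.

Lemma bregman_xlnx_ge0 u c : 0 < u -> 0 < c ->
  0 <= bregman xlnx xlnx_slope u c.
Proof.
move=> u0 c0; rewrite -[u]lnK ?posrE// -[c]lnK ?posrE// bregman_expR.
exact: exp_div_ge0.
Qed.

Lemma xlnx_bregman_convex a b : 0 < a -> bregman_convex xlnx xlnx_slope a b.
Proof.
move=> a0; have pos u : a <= u <= b -> 0 < u.
  by move=> /andP[au _]; exact: lt_le_trans au.
split.
- by apply: measurable_funM.
- by apply: measurable_funD.
- pose L := `|ln a| + `|ln b|; pose M := `|a| + `|b|.
  exists (M * L + L + 1) => u uI.
  have lnL : `|ln u| <= L.
    have u0 := pos _ uI; have /andP[au ub] := uI.
    have b0 := lt_le_trans u0 ub.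
    by apply: itv_norm_le; rewrite !ler_ln ?posrE// au.
  have uM := itv_norm_le uI.
  have L0 : 0 <= L by exact: le_trans lnL.
  have M0 : 0 <= M by exact: le_trans uM.
  have ML0 : 0 <= M * L by exact: mulr_ge0.
  have uL : `|xlnx u| <= M * L by rewrite normrM ler_pM.
  split; first by lra.
  by rewrite (le_trans (ler_normD _ _))// normr1; lra.
- by move=> u c uI cI; apply: bregman_xlnx_ge0; exact: pos.
- move=> u0 c0 /pos u0p /pos c0p.
  (* The partial derivatives of the divergence at (u0, c0). *)
  exists (ln u0 - ln c0), (1 - u0 / c0) => u c /pos up /pos cp.
  (* [bregman u c] minus its affine minorant is [bregman u (c * u0 / c0)]. *)
  have wp : 0 < c * (u0 / c0) by rewrite mulr_gt0// divr_gt0.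
  have := bregman_xlnx_ge0 up wp.
  rewrite !bregman_xlnx lnM ?posrE ?divr_gt0// ln_div ?posrE// => h.
  have c0E : u0 / c0 * c0 = u0 by rewrite divfK// gt_eqF.
  by move: h c0E; set r := u0 / c0; lra.
Qed.

End Kernels.

(** * Unbounded variables *)

Section OrderStatisticInequalities.
Context d (T : measurableType d) (R : realType) (P : probability T R).
Variables (n : nat) (X : 'I_n -> {RV P >-> R}).
Hypothesis indepX : mutually_independent X.
Variables (m p q : nat) (c : R).
Hypotheses (mn : (m.+1 < n)%N) (pn : (p < n)%N) (qn : (q < n)%N).
Hypothesis c_ge0 : (0 <= c)%R.
Hypothesis leave_one_out : forall (K : R -> R -> R) x,
  (forall u, K u u = 0%R) -> (forall u v, 0 <= K u v)%R ->
  (\sum_(i < n) K (ostat (enum 'I_n) p x) (ostat (seq.rem i (enum 'I_n)) m x) <=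
  c * K (ostat (enum 'I_n) p x) (ostat (enum 'I_n) q x))%R.
Local Notation Z := (fun w => ostat (enum 'I_n) p (joint X w)).
Local Notation Z' := (fun w => ostat (enum 'I_n) q (joint X w)).

Let mZ : measurable_fun setT Z. Proof. exact: measurable_ostat_joint. Qed.
Let mZ' : measurable_fun setT Z'. Proof. exact: measurable_ostat_joint. Qed.

Lemma ostat_variance_le : square_integrable P Z ->
  'V_P[Z] <= c%:E * 'E_P[fun w => ((Z w - Z' w) ^+ 2)%R].
Proof.
move=> Z2.
have Z2i : P.-integrable setT (EFin \o (fun w => Z w ^+ 2)%R).
  exact: Lfun2_integrable_sqr.
have Z1 : Z \in Lfun P 1 by rewrite Lfun_subset12 ?fin_num_measure.
have Zi : P.-integrable setT (EFin \o Z) by exact/Lfun1_integrable.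
have -> : 'V_P[Z] = (\int[P]_w (Z w ^+ 2) - (\int[P]_w Z w) ^+ 2)%R%:E.
  rewrite varianceE// unlock EFinB; congr (_ - _).
    by rewrite fineK//; exact: integrable_fin_num.
  by rewrite EFin_expe fineK//; exact: integrable_fin_num.
rewrite unlock.
apply: (@gap_limit _ _ _ P (fun z => z ^+ 2)%R (fun N w => clamp N (Z w)) Z
  (fun w => `|Z w|)%R (fun w => Z w ^+ 2)%R).
- exact: measurable_funX.
- by move=> N; apply: measurableT_comp => //; exact: measurable_clamp.
- exact: mZ.
- by move=> w; exact: clamp_near.
- exact: integrable_norm.
- by move=> N w; exact: clamp_norm_le.
- exact: Z2i.
- move=> N w; rewrite normrX -(real_normK (num_real (Z w)))//.
  by rewrite lerXn2r ?nnegrE//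
    clamp_norm_le.
- exact: exprn_continuous.
move=> N.
apply: (ostat_gap_le indepX (sqr_bregman_convex (- N%:R) N%:R)
  (measurable_clamp N) (clamp_itv N) mn pn qn c_ge0 leave_one_out
  (K := fun u v => (u - v) ^+ 2)%R).
  by apply: measurable_funX; exact: measurable_funB.
move=> u v; rewrite bregman_sqr.
apply: (@clamp_contract _ (fun u v => (u - v) ^+ 2)%R).
- by move=> z; rewrite subrr expr0n.
- by move=> y z; exact: sqr_ge0.
- by move=> {u v} u z v /orP[] /andP[? ?]; split; nra.
Qed.

Lemma ostat_entropy_le (l : R) :
  'E_P[fun w => expR (l * Z w)] < +oo ->
  'E_P[fun w => (`|Z w| * expR (l * Z w))%R] < +oo ->
  entropy P (fun w => expR (l * Z w)) <=
  c%:E * 'E_P[fun w => exp_div (l * Z w) (l * Z' w)].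
Proof.
rewrite !unlock => Eoo EZoo.
pose Y := fun w => (l * Z w)%R; pose Y' := fun w => (l * Z' w)%R.
have mY : measurable_fun setT Y by exact: measurable_funM.
have mY' : measurable_fun setT Y' by exact: measurable_funM.
have meY : measurable_fun setT (fun w => expR (Y w)) by exact: measurableT_comp.
have eYi : P.-integrable setT (EFin \o (fun w => expR (Y w))).
  apply/integrableP; split; first exact/measurable_EFinP.
  by under eq_integral do rewrite /= ger0_norm ?expR_ge0//.
have YeYi : P.-integrable setT (EFin \o (fun w => `|Y w| * expR (Y w))%R).
  rewrite (_ : _ \o _ =
    fun w => (`|l|%:E * (`|Z w| * expR (Y w))%:E)); last first.
    by apply/funext => w; rewrite /= normrM -mulrA EFinM.
  apply: integrableZl => //; apply/integrableP; split.
    apply/measurable_EFinP; apply: measurable_funM => //.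
    exact: measurableT_comp.
  by under eq_integral do rewrite /= ger0_norm ?mulr_ge0 ?expR_ge0//.
(* Positivity turns [lne] into [ln] and makes y log y continuous at the mean. A zero mean would
   force the positive function exp(Y) to vanish almost everywhere. *)
have E0 : (0 < \int[P]_w expR (Y w))%R.
  rewrite lt_neqAle Rintegral_ge0 ?andbT; last by move=> w _; exact: expR_ge0.
  apply/eqP => eY0.
  have : \int[P]_w `|(EFin \o (fun w => expR (Y w))) w| = 0.
    under eq_integral do rewrite /= ger0_norm ?expR_ge0//.
    rewrite -[LHS]fineK ?integrable_fin_num//.
    by rewrite -[fine _]/(Rintegral _ _ _) -eY0.
  move/(ae_eq_integral_abs P measurableT (proj2 (measurable_EFinP _ _) meY)).
  move=> [A [mA PA0 sA]].
  have : P setT <= P A.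
    apply: le_measure; rewrite ?inE// => w _; apply: sA => /= /(_ I) [].
    by move/eqP; rewrite gt_eqF// expR_gt0.
  by rewrite PA0 probability_setT; rewrite lee_fin ler10.
rewrite /entropy !unlock.
have xi : P.-integrable setT (EFin \o (fun w => xlnx (expR (Y w)))).
  apply/integrableP; split.
    apply/measurable_EFinP; apply: measurableT_comp => //.
    exact: bc_measurable (xlnx_bregman_convex 1 ltr01).
  have /integrableP[_] := YeYi.
  under eq_integral do rewrite /= normrM normr_id (ger0_norm (expR_ge0 _)).
  by under [in X in _ -> X]eq_integral do
    rewrite /= /xlnx expRK normrM (ger0_norm (expR_ge0 _)) mulrC.
have -> : \int[P]_w (expR (l * Z w))%:E = (\int[P]_w expR (Y w))%R%:E.
  by rewrite fineK//; exact: integrable_fin_num eYi.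
have -> : \int[P]_w (expR (l * Z w) * ln (expR (l * Z w)))%:E =
    (\int[P]_w xlnx (expR (Y w)))%R%:E.
  by rewrite fineK//; exact: integrable_fin_num xi.
rewrite lne_EFin// -EFinM -EFinB.
apply: (@gap_limit _ _ _ P (@xlnx R) (fun N w => expR (clamp N (Y w)))
  (fun w => expR (Y w)) (fun w => expR (Y w) + 1)%R
  (fun w => `|Y w| * expR (Y w) + 1)%R).
- exact: bc_measurable (xlnx_bregman_convex 1 ltr01).
- move=> N; apply: measurableT_comp => //.
  by apply: measurableT_comp => //; exact: measurable_clamp.
- exact: meY.
- by move=> w; apply: filterS (clamp_near (Y w)) => N ->.
- rewrite (_ : _ \o _ = fun w => ((expR (Y w))%:E + 1)%E)//.
  by apply: integrableD => //; exact: finite_measure_integrable_cst.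
- by move=> N w; rewrite ger0_norm ?expR_ge0// expR_clamp_le.
- rewrite (_ : _ \o _ = fun w => ((`|Y w| * expR (Y w))%:E + 1)%E)//.
  by apply: integrableD => //; exact: finite_measure_integrable_cst.
- move=> N w; rewrite /xlnx expRK normrM (ger0_norm (expR_ge0 _)) mulrC.
  exact: clamp_expR_le.
- by apply: continuousM => //; exact: continuous_ln.
move=> N.
(* Clamping the exponent keeps the variable away from 0, where the slope of y log y is unbounded. *)
have th_itv z : (expR (- N%:R) <= expR (clamp N (l * z)) <= expR N%:R)%R.
  by rewrite !ler_expR clamp_itv.
apply: (ostat_gap_le indepX
  (xlnx_bregman_convex (expR N%:R) (expR_gt0 (- N%:R)))
  _ th_itv mn pn qn c_ge0 leave_one_out
  (K := fun u v => exp_div (l * u) (l * v))).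
- apply: measurableT_comp => //; apply: measurableT_comp => //.
  exact: measurable_clamp.
- apply: measurable_funD; last exact: measurableT_comp.
  apply: measurable_funM; first exact: measurableT_comp.
  by apply: measurable_funB => //; exact: measurable_funB.
- move=> u v; rewrite bregman_expR.
  exact: (clamp_contract (@exp_div_id R) (@exp_div_ge0 R) (@exp_div_mid R)).
Qed.

End OrderStatisticInequalities.

(** The order statistic under study always fills the first argument of the divergence; here it is
    [u], the larger of the two. *)
Lemma exp_div_psi (R : realType) (l u v : R) :
  (expR (l * v) * psi (l * (u - v)) = exp_div (l * u) (l * v))%R.
Proof.
rewrite psiE mulrDr mulr1 addrC /exp_div; congr (_ + _)%R.
rewrite mulrCA -expRD; have -> : (l * v + l * (u - v) = l * u)%R by ring.
by ring.
Qed.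

(** The roles are exchanged: the order statistic under study is now [v], the smaller one. *)
Lemma exp_div_tau (R : realType) (l u v : R) :
  (expR (l * v) * tau (l * (u - v)) = exp_div (l * v) (l * u))%R.
Proof.
have e : (expR (l * v) * expR (l * (u - v)) = expR (l * u))%R.
  by rewrite -expRD; congr expR; ring.
by rewrite /tau -addrA mulrDr e /exp_div; ring.
Qed.

Theorem proposition2p3 (d : measure_display) (T : measurableType d)
    (R : realType) (P : probability T R) (n : nat)
    (X : 'I_n -> {RV P >-> R}) :
  (2 <= n)%N ->
  mutually_independent X ->
  identically_distributed X ->
  (forall k : nat, (1 <= k)%N -> (2 * k <= n)%N ->
    (square_integrable P (order_stat X k) ->
      'V_P[order_stat X k] <=
        k%:R%:E *
        'E_P[fun w => ((order_stat X k w - order_stat X k.+1 w) ^+ 2)%R]) /\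
    (forall l : R,
      'E_P[fun w => expR (l * order_stat X k w)] < +oo ->
      'E_P[fun w => (`|order_stat X k w| * expR (l * order_stat X k w))%R]
        < +oo ->
      entropy P (fun w => expR (l * order_stat X k w)) <=
        k%:R%:E *
        'E_P[fun w => (expR (l * order_stat X k.+1 w) *
               psi (l * (order_stat X k w - order_stat X k.+1 w)))%R])) /\
  (forall k : nat, (n < 2 * k)%N -> (k <= n)%N ->
    (square_integrable P (order_stat X k) ->
      'V_P[order_stat X k] <=
        (n - k + 1)%:R%:E *
        'E_P[fun w => ((order_stat X k.-1 w - order_stat X k w) ^+ 2)%R]) /\
    (forall l : R,
      'E_P[fun w => expR (l * order_stat X k w)] < +oo ->
      'E_P[fun w => (`|order_stat X k w| * expR (l * order_stat X k w))%R]
        < +oo ->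
      entropy P (fun w => expR (l * order_stat X k w)) <=
        (n - k + 1)%:R%:E *
        'E_P[fun w => (expR (l * order_stat X k w) *
               tau (l * (order_stat X k.-1 w - order_stat X k w)))%R])).
Proof.
move=> n2 indepX _.
have osE k : order_stat X k = fun w => ostat (enum 'I_n) k.-1 (joint X w).
  by apply/funext => w; exact: order_statE.
split=> k kn nk.
(* From here [k] counts from 0: it is the rank of the order statistic and the one read in the
   reduced samples; the neighbour has rank [k.+1]. *)
- case: k kn nk => // k _ kn.
  have kn1 : (k.+1 < n)%N by lia.
  have loo (K : R -> R -> R) x K0 K_ge0 :=
    @sum_leave_one_out_top R n K k x K0 K_ge0 kn1.
  rewrite !osE /=; split=> [Z2|l El EZl].
    exact: (ostat_variance_le indepX kn1 (ltnW kn1) kn1 (ler0n _ _) loo).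
  under [X in 'E_P[X]]eq_fun do rewrite exp_div_psi.
  exact: (ostat_entropy_le indepX kn1 (ltnW kn1) kn1 (ler0n _ _) loo).
(* Since n >= 2 and n < 2k, k is at least 2. Counting from 0, the order statistic has rank [j.+1];
   its neighbour and the reduced samples are read at rank [j]. *)
- have [j kj] : exists j, k = j.+2 by exists k.-2; lia.
  have jn : (j.+1 < n)%N by lia.
  have -> : (n - k + 1 = n - j.+1)%N by lia.
  have loo (K : R -> R -> R) x K0 K_ge0 :=
    @sum_leave_one_out_bottom R n K j x K0 K_ge0 jn.
  rewrite !osE kj /=; split=> [Z2|l El EZl].
    under [X in 'E_P[X]]eq_fun do rewrite -sqrrN opprB.
    exact: (ostat_variance_le indepX jn jn (ltnW jn) (ler0n _ _) loo).
  under [X in 'E_P[X]]eq_fun do rewrite exp_div_tau.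
  exact: (ostat_entropy_le indepX jn jn (ltnW jn) (ler0n _ _) loo).
Qed.
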